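(* Let $\mathcal{T}$ be a triangulated category with suspension functor $\Sigma$, and let $X$ and $Y$ be objects of $\mathcal{T}$. Suppose $R$ is a graded-commutative ring acting centrally on $\mathcal{T}$ such that the $R$-module $\operatorname{Hom}_{\mathcal{T}}^*(X,X)$ is eventually Noetherian of finite length, and suppose that $\operatorname{thick}_{\mathcal{T}}(X)$ is either a left or a right Auslander subcategory of $\mathcal{T}$. Let $r_1,\dots,r_c$ be a sequence of positive degree homogeneous elements of $R$ reducing the complexity of $X$, where $c=\operatorname{cx}_{\mathcal{T}}X$. Then the following are equivalent: (i) There exists an integer $n\in\mathbb{Z}$ such that $\operatorname{Hom}_{\mathcal{T}}(X,\Sigma^iY)=0$ for $n\le i\le n+|r_1|+\cdots+|r_c|-c$. (ii) $\operatorname{Hom}_{\mathcal{T}}(X,\Sigma^iY)=0$ for all $i\in\mathbb{Z}$.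
   Context: Central actions. For objects $X,Y$ of a triangulated category $\mathcal{T}$, put $\operatorname{Hom}_{\mathcal{T}}^*(X,Y)=\bigoplus_{i\in\mathbb{Z}}\operatorname{Hom}_{\mathcal{T}}(X,\Sigma^iY)$ and $\operatorname{Hom}_{\mathcal{T}}^{\ge n}(X,Y)=\bigoplus_{i\ge n}\operatorname{Hom}_{\mathcal{T}}(X,\Sigma^iY)$. The graded center $Z^*(\mathcal{T})$ has as its degree $n$ component the set of natural transformations $f:\operatorname{Id}\to\Sigma^n$ with $f_{\Sigma X}=(-1)^n\Sigma f_X$ for all objects $X$. A graded-commutative ring is a graded ring $R=\bigoplus_{i\ge 0}R_i$ with $r_1r_2=(-1)^{|r_1||r_2|}r_2r_1$ for homogeneous $r_1,r_2$. $R$ acts centrally on $\mathcal{T}$ if there is a (given) graded ring homomorphism $R\to Z^*(\mathcal{T})$; it induces graded ring homomorphisms $\varphi_X:R\to\operatorname{Hom}_{\mathcal{T}}^*(X,X)$ for each object $X$, and $\operatorname{Hom}_{\mathcal{T}}^*(X,Y)$ becomes an $R$-module via $\varphi_X$ or, equivalently up to the sign $(-1)^{|r||f|}$, via $\varphi_Y$. Finiteness. $\operatorname{Hom}_{\mathcal{T}}^*(X,Y)$ is eventually Noetherian of finite length (over $R$) if there is $n_0\in\mathbb{Z}$ such that the $R$-module $\operatorname{Hom}_{\mathcal{T}}^{\ge n_0}(X,Y)$ is Noetherian and $\ell_{R_0}(\operatorname{Hom}_{\mathcal{T}}(X,\Sigma^nY))<\infty$ for every $n\ge n_0$, where $\ell_{R_0}$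 denotes length over $R_0$. Complexity. $\operatorname{cx}_{\mathcal{T}}(X,Y)$ is the Krull dimension of $\operatorname{Hom}_{\mathcal{T}}^*(X,Y)$ as a module over $R^{\mathrm{ev}}=\bigoplus_{i\ge0}R_{2i}$, and $\operatorname{cx}_{\mathcal{T}}X=\operatorname{cx}_{\mathcal{T}}(X,X)$. When $\operatorname{Hom}_{\mathcal{T}}^*(X,Y)$ is eventually Noetherian of finite length, this number is finite and equals the infimum of all integers $t\ge 0$ for which there is a real number $a$ with $\ell_{R_0}(\operatorname{Hom}_{\mathcal{T}}(X,\Sigma^nY))\le an^{t-1}$ for $n\gg0$; this is the value meant here. Koszul objects. For a homogeneous $r\in R$, the Koszul object $X/\!\!/r$ is defined (up to isomorphism) by a distinguished triangle $X\xrightarrow{\varphi_X(r)}\Sigma^{|r|}X\to X/\!\!/r\to\Sigma X$. Inductively, $X/\!\!/(r_1,\dots,r_i)=(X/\!\!/(r_1,\dots,r_{i-1}))/\!\!/r_i$. Reducing complexity. If $\operatorname{Hom}_{\mathcal{T}}^*(X,X)$ is eventually Noetherian of finite length and $c=\operatorname{cx}_{\mathcal{T}}X$, a sequence $r_1,\dots,r_c$ of homogeneous elements of $R$ of positive degree reduces the complexity of $X$ if $\operatorname{cx}_{\mathcal{T}}X/\!\!/(r_1,\dots,r_i)=c-i$ for $1\le i\le c$ (for $c=0$ the sequence is empty). Thick and Auslander subcategories. A thick subcategory is a full triangulated subcategory closed under direct summands; $\operatorname{thick}_{\mathcal{T}}(X)$ is the smallest thick subcategory containing $X$. $\operatorname{Hom}_{\mathcal{T}}^*(X,Y)$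 is eventually zero if $\operatorname{Hom}_{\mathcal{T}}(X,\Sigma^nY)=0$ for $n\gg0$. A full subcategory $\mathcal{C}$ of $\mathcal{T}$ is a left Auslander subcategory if for every $X\in\mathcal{C}$ there is an integer $d_X$, depending only on $X$, such that whenever $\operatorname{Hom}_{\mathcal{T}}^*(X,Y)$ is eventually zero for some $Y\in\mathcal{T}$, then $\operatorname{Hom}_{\mathcal{T}}(X,\Sigma^nY)=0$ for $n\ge d_X$. Dually, $\mathcal{C}$ is a right Auslander subcategory if for every $X\in\mathcal{C}$ there is an integer $d_X$, depending only on $X$, such that whenever $\operatorname{Hom}_{\mathcal{T}}^*(Y,X)$ is eventually zero for some $Y\in\mathcal{T}$, then $\operatorname{Hom}_{\mathcal{T}}(Y,\Sigma^nX)=0$ for $n\ge d_X$. *)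

(* Defs.v *)
From HB Require Import structures.
From mathcomp Require Import all_boot all_order all_algebra.
From mathcomp Require Import boolp classical_sets cardinality reals.
From mathcomp Require Import zify.

Set Implicit Arguments.
Unset Strict Implicit.
Unset Printing Implicit Defensive.

Import Order.TTheory GRing.Theory Num.Theory.

Local Open Scope classical_set_scope.
Local Open Scope ring_scope.

Record preadditive := Preadditive {
  ob :> Type;
  hom : ob -> ob -> zmodType;
  idm : forall X, hom X X;
  cmp : forall X Y Z, hom Y Z -> hom X Y -> hom X Z;
  cmpA : forall W X Y Z (h : hom Y Z) (g : hom X Y) (f : hom W X),
    cmp h (cmp g f) = cmp (cmp h g) f;
  cmp1m : forall X Y (f : hom X Y), cmp (idm Y) f = f;
  cmpm1 : forall X Y (f : hom X Y), cmp f (idm X) = f;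
  cmpDl : forall X Y Z (g g' : hom Y Z) (f : hom X Y),
    cmp (g + g') f = cmp g f + cmp g' f;
  cmpDr : forall X Y Z (g : hom Y Z) (f f' : hom X Y),
    cmp g (f + f') = cmp g f + cmp g f' }.

Arguments hom {p} X Y.
Arguments idm {p} X.
Arguments cmp {p X Y Z} g f.

Notation "g ∘ f" := (cmp g f) (at level 40, left associativity).

Record endofunctor (C : preadditive) := Endofunctor {
  fob :> C -> C;
  fmap : forall X Y, hom X Y -> hom (fob X) (fob Y);
  fmap1 : forall X, fmap (idm X) = idm (fob X);
  fmapM : forall X Y Z (g : hom Y Z) (f : hom X Y),
    fmap (g ∘ f) = fmap g ∘ fmap f;
  fmapD : forall X Y (f f' : hom X Y), fmap (f + f') = fmap f + fmap f' }.

Arguments fmap {C} F {X Y} f : rename.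

Definition idF (C : preadditive) : endofunctor C :=
  @Endofunctor C (fun X => X) (fun _ _ f => f)
    (fun _ => erefl) (fun _ _ _ _ _ => erefl) (fun _ _ _ _ => erefl).

Section CompF.
Variables (C : preadditive) (F G : endofunctor C).

Lemma compF1 X : fmap F (fmap G (idm X)) = idm (F (G X)).
Proof. by rewrite !fmap1. Qed.

Lemma compFM X Y Z (g : hom Y Z) (f : hom X Y) :
  fmap F (fmap G (g ∘ f)) = fmap F (fmap G g) ∘ fmap F (fmap G f).
Proof. by rewrite !fmapM. Qed.

Lemma compFD X Y (f f' : hom X Y) :
  fmap F (fmap G (f + f')) = fmap F (fmap G f) + fmap F (fmap G f').
Proof. by rewrite !fmapD. Qed.

Definition compF : endofunctor C :=
  @Endofunctor C (fun X => F (G X)) (fun X Y f => fmap F (fmap G f))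
    compF1 compFM compFD.
End CompF.

Fixpoint powF (C : preadditive) (F : endofunctor C) (n : nat) : endofunctor C :=
  if n is n'.+1 then compF F (powF F n') else idF C.

Section CategoricalNotions.
Variable C : preadditive.
Implicit Types A B X Y Z : C.

Definition is_iso X Y (f : hom X Y) : Prop :=
  exists g : hom Y X, g ∘ f = idm X /\ f ∘ g = idm Y.

Definition is_zero_object Z : Prop :=
  forall X, (forall f : hom X Z, f = 0) /\ (forall f : hom Z X, f = 0).

Definition is_biproduct A B Z : Prop :=
  exists (iA : hom A Z) (iB : hom B Z) (pA : hom Z A) (pB : hom Z B),
    [/\ pA ∘ iA = idm A, pB ∘ iB = idm B, pA ∘ iB = 0, pB ∘ iA = 0
      & iA ∘ pA + iB ∘ pB = idm Z].

Definition direct_summand A Z : Prop := exists B, is_biproduct A B Z.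

End CategoricalNotions.

(* The suspension is an additive auto-equivalence with a chosen quasi-inverse,
   so suspensions that are not strictly invertible are allowed. *)
Record triangulated := Triangulated {
  cat :> preadditive;
  zero_object : exists Z : cat, is_zero_object Z;
  biproducts : forall A B : cat, exists Z, is_biproduct A B Z;

  sus : endofunctor cat;
  desus : endofunctor cat;
  sus_unit : forall X : cat, hom X (desus (sus X));
  sus_counit : forall X : cat, hom (sus (desus X)) X;
  sus_unit_iso : forall X, is_iso (sus_unit X);
  sus_counit_iso : forall X, is_iso (sus_counit X);
  sus_unit_nat : forall (X Y : cat) (f : hom X Y),
    sus_unit Y ∘ f = fmap desus (fmap sus f) ∘ sus_unit X;
  sus_counit_nat : forall (X Y : cat) (f : hom X Y),
    f ∘ sus_counit X = sus_counit Y ∘ fmap sus (fmap desus f);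

  dist : forall X Y Z : cat, hom X Y -> hom Y Z -> hom Z (sus X) -> Prop;
  dist_iso : forall (X Y Z X' Y' Z' : cat)
      (u : hom X Y) (v : hom Y Z) (w : hom Z (sus X))
      (u' : hom X' Y') (v' : hom Y' Z') (w' : hom Z' (sus X'))
      (a : hom X X') (b : hom Y Y') (c : hom Z Z'),
    is_iso a -> is_iso b -> is_iso c ->
    b ∘ u = u' ∘ a -> c ∘ v = v' ∘ b -> fmap sus a ∘ w = w' ∘ c ->
    dist u v w -> dist u' v' w';
  dist_id : forall X Z : cat, is_zero_object Z ->
    dist (idm X) (0 : hom X Z) (0 : hom Z (sus X));
  dist_cone : forall (X Y : cat) (u : hom X Y),
    exists (Z : cat) (v : hom Y Z) (w : hom Z (sus X)), dist u v w;
  dist_rot : forall (X Y Z : cat)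
      (u : hom X Y) (v : hom Y Z) (w : hom Z (sus X)),
    dist u v w <-> dist v w (- fmap sus u);
  dist_mor : forall (X Y Z X' Y' Z' : cat)
      (u : hom X Y) (v : hom Y Z) (w : hom Z (sus X))
      (u' : hom X' Y') (v' : hom Y' Z') (w' : hom Z' (sus X'))
      (a : hom X X') (b : hom Y Y'),
    dist u v w -> dist u' v' w' -> b ∘ u = u' ∘ a ->
    exists c : hom Z Z', c ∘ v = v' ∘ b /\ fmap sus a ∘ w = w' ∘ c;
  dist_octahedron : forall (X1 X2 X3 Z12 Z23 Z13 : cat)
      (u12 : hom X1 X2) (u23 : hom X2 X3)
      (v12 : hom X2 Z12) (w12 : hom Z12 (sus X1))
      (v23 : hom X3 Z23) (w23 : hom Z23 (sus X2))
      (v13 : hom X3 Z13) (w13 : hom Z13 (sus X1)),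
    dist u12 v12 w12 -> dist u23 v23 w23 -> dist (u23 ∘ u12) v13 w13 ->
    exists (m1 : hom Z12 Z13) (m3 : hom Z13 Z23),
      [/\ m1 ∘ v12 = v13 ∘ u23, w13 ∘ m1 = w12, m3 ∘ v13 = v23,
          w23 ∘ m3 = fmap sus u12 ∘ w13
        & dist m1 m3 (fmap sus v12 ∘ w23)] }.

Arguments sus {t}.
Arguments desus {t}.
Arguments sus_unit {t} X.
Arguments sus_counit {t} X.
Arguments dist {t X Y Z} u v w.

Section Powers.
Variable T : triangulated.
Implicit Types X Y : T.

Definition suspow (i : int) : endofunctor T :=
  match i with Posz n => powF sus n | Negz n => powF desus n.+1 end.

(* [pow_add], [pow_comm] and [powz_add] are identities when the suspension is a
   strict automorphism; here they mediate between differently written powers. *)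
Fixpoint pow_add (n m : nat) X :
    hom (powF sus n (powF sus m X)) (powF sus (n + m) X) :=
  if n is n'.+1 then fmap sus (pow_add n' m X) else idm _.

Fixpoint pow_comm (n : nat) X :
    hom (sus (powF sus n X)) (powF sus n (sus X)) :=
  if n is n'.+1 then fmap sus (pow_comm n' X) else idm _.

(* [subz k n] is [k - n], computing in a way that lets [powz_add] below be
   defined without transporting along equalities of integers. *)
Definition predz (k : int) : int :=
  match k with
  | Posz n.+1 => Posz n | Posz 0%N => Negz 0%N | Negz n => Negz n.+1
  end.

Fixpoint subz (k : int) (n : nat) : int :=
  if n is n'.+1 then subz (predz k) n' else k.

Definition powz_succ (k : int) X :
    hom (sus (suspow (predz k) X)) (suspow k X) :=
  match k return hom (sus (suspow (predz k) X)) (suspow k X) with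
  | Posz n.+1 => idm _
  | Posz 0%N => sus_counit X
  | Negz n => sus_counit (powF desus n.+1 X)
  end.

Fixpoint powz_add (n : nat) (k : int) X :
    hom (powF sus n (suspow (subz k n) X)) (suspow k X) :=
  if n is n'.+1 then powz_succ k X ∘ fmap sus (powz_add n' (predz k) X)
  else idm _.

Lemma predzE k : predz k = k - 1.
Proof. by case: k => [[|n]|n] //=; lia. Qed.

Lemma subzE k n : subz k n = k - n%:Z.
Proof. by elim: n k => [|n IHn] k /=; rewrite ?subr0 // IHn predzE; lia. Qed.

End Powers.

(* [grproj n] is the projection onto the degree [n] component. *)
Record gradedRing := GradedRing {
  grring :> pzRingType;
  grproj : nat -> grring -> grring;
  grprojD : forall n r s, grproj n (r + s) = grproj n r + grproj n s;
  grproj_id : forall n m r,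
    grproj n (grproj m r) = if n == m then grproj m r else 0;
  gr_finite : forall r, exists N, r = \sum_(n < N) grproj n r;
  gr1 : grproj 0%N 1 = 1;
  grM : forall m n r s, grproj m r = r -> grproj n s = s ->
    grproj (m + n) (r * s) = r * s }.

Arguments grproj {g} n r.

Definition homogeneous (R : gradedRing) (n : nat) : set R :=
  [set r | grproj n r = r].

Definition graded_commutative (R : gradedRing) : Prop :=
  forall m n (r s : R), homogeneous m r -> homogeneous n s ->
    r * s = (-1) ^+ (m * n) * (s * r).

Section GradedCenter.
Variable T : triangulated.

(* The sign lives in [int]: Hom groups carry no scalars besides integers. *)
Definition graded_center (n : nat) :
    set (forall X : T, hom X (powF sus n X)) :=
  [set f | (forall (X Y : T) (g : hom X Y), f Y ∘ g = fmap (powF sus n) g ∘ f X)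
        /\ (forall X : T,
              f (sus X) = (pow_comm n X ∘ fmap sus (f X)) *~ (-1) ^+ n)].

End GradedCenter.

(* [zeta n r] is the degree [n] component of the image of [r] in the graded
   center.  The product of [Hom^*(X,X)] is [f g = Sigma^|g|(f) o g], so
   [zetaM] says that each [phi_X] is multiplicative. *)
Record central_action (R : gradedRing) (T : triangulated) := CentralAction {
  zeta : forall n : nat, R -> forall X : T, hom X (powF sus n X);
  zeta_center : forall n r, graded_center (zeta n r);
  zeta_graded : forall n r X, zeta n (grproj n r) X = zeta n r X;
  zetaD : forall n r s X, zeta n (r + s) X = zeta n r X + zeta n s X;
  zeta1 : forall X, zeta 0%N 1 X = idm X;
  zetaM : forall m n r s X, homogeneous m r -> homogeneous n s ->
    zeta (n + m) (r * s) X =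
      pow_add n m X ∘ fmap (powF sus n) (zeta m r X) ∘ zeta n s X }.

Section DirectSum.
Variables (I : Type) (V : I -> zmodType).

Record dsum := DSum {
  dcomp :> forall i, V i;
  dsum_finite : finite_set [set i | dcomp i != 0] }.

HB.instance Definition _ := gen_eqMixin dsum.
HB.instance Definition _ := gen_choiceMixin dsum.

Lemma dsumP (x y : dsum) : (forall i, x i = y i) -> x = y.
Proof.
case: x y => [x fx] [y fy] /= exy.
have {}exy : x = y by apply: functional_extensionality_dep.
by case: _ / exy fy => fy; congr DSum; apply: Prop_irrelevance.
Qed.

Lemma dsum0_finite : finite_set [set i | (0 : V i) != 0].
Proof. by apply: (sub_finite_set _ (finite_set0 I)) => i /=; rewrite eqxx. Qed.

Lemma dsumN_finite (x : dsum) : finite_set [set i | - x i != 0].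
Proof.
by apply: (sub_finite_set _ (dsum_finite x)) => i /=; rewrite oppr_eq0.
Qed.

Lemma dsumD_finite (x y : dsum) : finite_set [set i | x i + y i != 0].
Proof.
apply: (@sub_finite_set _ _ ([set i | x i != 0] `|` [set i | y i != 0])).
  move=> i /=; case: (eqVneq (x i) 0) => [-> | ]; last by left.
  by rewrite add0r; right.
by rewrite finite_setU; split; apply: dsum_finite.
Qed.

Definition dsum0 := DSum dsum0_finite.
Definition dsum_opp x := DSum (dsumN_finite x).
Definition dsum_add x y := DSum (dsumD_finite x y).

Lemma dsum_addA : associative dsum_add.
Proof. by move=> x y z; apply: dsumP => i /=; rewrite addrA. Qed.

Lemma dsum_addC : commutative dsum_add.
Proof. by move=> x y; apply: dsumP => i /=; rewrite addrC. Qed.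

Lemma dsum_add0 : left_id dsum0 dsum_add.
Proof. by move=> x; apply: dsumP => i /=; rewrite add0r. Qed.

Lemma dsum_addN : left_inverse dsum0 dsum_opp dsum_add.
Proof. by move=> x; apply: dsumP => i /=; rewrite addNr. Qed.

HB.instance Definition _ :=
  GRing.isZmodule.Build dsum dsum_addA dsum_addC dsum_add0 dsum_addN.

End DirectSum.

Section PreadditiveFacts.
Variable C : preadditive.
Implicit Types X Y Z : C.

Lemma cmp0m X Y Z (f : hom X Y) : (0 : hom Y Z) ∘ f = 0.
Proof. by apply: (addrI (0 ∘ f)); rewrite -cmpDl !addr0. Qed.

Lemma cmpm0 X Y Z (g : hom Y Z) : g ∘ (0 : hom X Y) = 0.
Proof. by apply: (addrI (g ∘ 0)); rewrite -cmpDr !addr0. Qed.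

Lemma fmap0 (F : endofunctor C) X Y : fmap F (0 : hom X Y) = 0.
Proof. by apply: (addrI (fmap F 0)); rewrite -fmapD !addr0. Qed.

Lemma cmp_suml n X Y Z (g : 'I_n -> hom Y Z) (f : hom X Y) :
  (\sum_i g i) ∘ f = \sum_i g i ∘ f.
Proof.
exact: (big_morph (fun g => g ∘ f) (fun g h => cmpDl g h f) (cmp0m _ f)).
Qed.

Lemma cmp_sumr n X Y Z (g : hom Y Z) (f : 'I_n -> hom X Y) :
  g ∘ (\sum_i f i) = \sum_i g ∘ f i.
Proof. exact: (big_morph (cmp g) (cmpDr g) (cmpm0 _ g)). Qed.

Lemma fmap_sum (F : endofunctor C) n X Y (f : 'I_n -> hom X Y) :
  fmap F (\sum_i f i) = \sum_i fmap F (f i).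
Proof. exact: (big_morph (fmap F) (@fmapD _ F X Y) (fmap0 F X Y)). Qed.

End PreadditiveFacts.

Lemma pow_add_nat (T : triangulated) n m (X Y : T) (f : hom X Y) :
  pow_add n m Y ∘ fmap (powF sus n) (fmap (powF sus m) f)
  = fmap (powF sus (n + m)) f ∘ pow_add n m X.
Proof.
elim: n => [|n IHn] /=; first by rewrite cmp1m cmpm1.
by rewrite -!fmapM IHn.
Qed.

Lemma powz_addA (T : triangulated) n m k (X Y : T)
    (f : forall k : int, hom X (suspow T k Y)) :
  powz_add (n + m) k Y ∘ fmap (powF sus (n + m)) (f (subz k (n + m)))
    ∘ pow_add n m X
  = powz_add n k Y ∘ fmap (powF sus n)
      (powz_add m (subz k n) Y
         ∘ fmap (powF sus m) (f (subz (subz k n) m))).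
Proof.
elim: n k => [|n IHn] k /=; first by rewrite cmpm1 cmp1m.
by rewrite -!cmpA -!fmapM -IHn -!cmpA.
Qed.

Section GradedRingFacts.
Variable R : gradedRing.
Implicit Types r s : R.

Lemma grproj0 n : grproj n (0 : R) = 0.
Proof. by apply: (addrI (grproj n 0)); rewrite -grprojD !addr0. Qed.

Lemma grproj_sum n m (r : 'I_m -> R) :
  grproj n (\sum_i r i) = \sum_i grproj n (r i).
Proof. exact: (big_morph _ (@grprojD R n) (grproj0 n)). Qed.

Definition gsize r : nat := sval (cid (gr_finite r)).

Lemma gsizeE r : r = \sum_(n < gsize r) grproj n r.
Proof. exact: (svalP (cid (gr_finite r))). Qed.

Lemma grproj_gsize r n : (gsize r <= n)%N -> grproj n r = 0.
Proof.
move=> le_n; rewrite [r in LHS]gsizeE grproj_sum big1 // => i _.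
by rewrite grproj_id gtn_eqF // (leq_trans (ltn_ord i)).
Qed.

Lemma gr_sumE r N : (gsize r <= N)%N -> r = \sum_(n < N) grproj n r.
Proof.
move=> leN; rewrite [LHS]gsizeE (big_ord_widen _ (fun n => grproj n r) leN).
rewrite [RHS](bigID (fun n : 'I_N => (n < gsize r)%N)) /=.
rewrite [X in _ = _ + X]big1 ?addr0 // => i.
by rewrite -leqNgt => /grproj_gsize.
Qed.

End GradedRingFacts.

Section HomStar.
Variables (R : gradedRing) (T : triangulated) (A : central_action R T).
Variables X Y : T.

Definition homStar & central_action R T : Type :=
  dsum (fun k : int => hom X (suspow T k Y)).

HB.instance Definition _ := GRing.Zmodule.on (homStar A).

(* Degree [k] component of [f . phi_X(r_n)], where [r_n] is the degree [n]
   component of [r]: this is [Sigma^n(f_(k-n)) o phi_X(r_n)]. *)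
Definition hact (n : nat) (r : R) (f : forall k, hom X (suspow T k Y))
    (k : int) : hom X (suspow T k Y) :=
  powz_add n k Y ∘ fmap (powF sus n) (f (subz k n)) ∘ zeta A n r X.

Definition hscale_fun (r : R) (f : homStar A) (k : int) :=
  \sum_(n < gsize r) hact n r f k.

Lemma zeta0 n : zeta A n 0 X = 0.
Proof. by apply: (addrI (zeta A n 0 X)); rewrite -zetaD !addr0. Qed.

Lemma zeta_sum n m (r : 'I_m -> R) :
  zeta A n (\sum_i r i) X = \sum_i zeta A n (r i) X.
Proof.
exact: (big_morph (fun r => zeta A n r X)
          (fun r s => zetaD A n r s X) (zeta0 n)).
Qed.

Lemma hactf0 n r f k : f (subz k n) = 0 -> hact n r f k = 0.
Proof. by move=> f0; rewrite /hact f0 fmap0 cmpm0 cmp0m. Qed.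

Lemma hact0 n r f k : grproj n r = 0 -> hact n r f k = 0.
Proof. by move=> r0; rewrite /hact -zeta_graded r0 zeta0 cmpm0. Qed.

Lemma hactM i j r s f k :
  hact (j + i) (grproj i r * grproj j s) f k = hact j s (hact i r f) k.
Proof.
rewrite /hact zetaM; try by rewrite /homogeneous /= grproj_id eqxx.
rewrite !zeta_graded !cmpA powz_addA -!cmpA; congr (_ ∘ _).
by rewrite cmpA -fmapM -cmpA.
Qed.

Lemma hscaleE r (f : homStar A) k N : (gsize r <= N)%N ->
  hscale_fun r f k = \sum_(n < N) hact n r f k.
Proof.
move=> leN; rewrite /hscale_fun (big_ord_widen _ (fun n => hact n r f k) leN).
rewrite [RHS](bigID (fun n : 'I_N => (n < gsize r)%N)) /=.
rewrite [X in _ = _ + X]big1 ?addr0 // => i.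
by rewrite -leqNgt => /grproj_gsize/hact0.
Qed.

Lemma hscale_finite r (f : homStar A) :
  finite_set [set k | hscale_fun r f k != 0].
Proof.
pose S := \bigcup_(n in `I_(gsize r)) ((fun k => subz k n) @^-1`
            [set k | f k != 0]).
apply: (@sub_finite_set _ _ S).
  move=> k /= nz; apply: contrapT => nS; case/negP: nz; apply/eqP.
  rewrite /hscale_fun big1 // => n _; apply: hactf0.
  by apply/eqP/negPn/negP => nf; apply: nS; exists (nat_of_ord n) => /=.
apply: bigcup_finite; first exact: finite_II.
move=> n _; apply: finite_preimage; last exact: dsum_finite.
by move=> k l _ _; rewrite !subzE => /addIr.
Qed.

Definition hscale (r : R) (f : homStar A) : homStar A :=
  DSum (hscale_finite r f).

Lemma hscaleM r s f : hscale r (hscale s f) = hscale (s * r) f.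
Proof.
apply: dsumP => k /=.
pose N := maxn (gsize (s * r)) (maxn (gsize r) (gsize s)).
have [leN1 leN2 leN3] :
    [/\ (gsize (s * r) <= N + N)%N, (gsize r <= N)%N & (gsize s <= N)%N].
  by rewrite /N; split; lia.
rewrite (hscaleE _ _ leN1) (hscaleE _ _ leN2).
have hactD n (t : 'I_N -> R) : hact n (\sum_i t i) f k = \sum_i hact n (t i) f k.
  by rewrite /hact zeta_sum cmp_sumr.
have -> : \sum_(n < N + N) hact n (s * r) f k =
    \sum_(n < N + N) \sum_(j < N) \sum_(i < N)
      hact n (grproj i s * grproj j r) f k.
  apply: eq_bigr => n _.
  rewrite {1}(gr_sumE leN2) mulr_sumr hactD; apply: eq_bigr => j _.
  by rewrite {1}(gr_sumE leN3) mulr_suml hactD.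
rewrite exchange_big; apply: eq_bigr => j _.
rewrite exchange_big /=.
transitivity (\sum_(i < N) hact j r (hact i s f) k); last first.
  apply: eq_bigr => i _; rewrite -hactM.
  have lt_ij : (j + i < N + N)%N by have := ltn_ord i; have := ltn_ord j; lia.
  rewrite (bigD1 (Ordinal lt_ij)) //= big1 ?addr0 // => n ne_n.
  apply: hact0; rewrite -(@grM _ i j) ?grproj_id ?eqxx //.
  case: eqP => // e_n; case/eqP: ne_n; apply: val_inj => /=.
  by rewrite e_n addnC.
rewrite /hact /= (hscaleE _ _ leN3) fmap_sum cmp_sumr cmp_suml.
by [].
Qed.

Lemma hscaleA (r s : R^c) f : hscale r (hscale s f) = hscale (r * s) f.
Proof. exact: hscaleM. Qed.

Lemma hscale1 : left_id 1 hscale.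
Proof.
move=> f; apply: dsumP => k /=; rewrite (@hscaleE _ _ _ (gsize (1 : R)).+1) //.
rewrite big_ord_recl big1 => [|i _].
  by rewrite /hact /= zeta1 cmp1m cmpm1 addr0.
by apply: hact0; have := grproj_id (lift ord0 i) 0 (1 : R); rewrite !gr1.
Qed.

Lemma hscaleDr : right_distributive hscale +%R.
Proof.
move=> r f g; apply: dsumP => k /=; rewrite -big_split.
by apply: eq_bigr => n _; rewrite /hact /= fmapD cmpDr cmpDl.
Qed.

Lemma hscaleDl f : {morph hscale^~ f : r s / r + s}.
Proof.
move=> r s; apply: dsumP => k /=.
pose N := maxn (gsize (r + s : R)) (maxn (gsize r) (gsize s)).
rewrite (@hscaleE (r + s : R) _ _ N) ?leq_maxl //.
rewrite (@hscaleE r _ _ N) ?(@hscaleE s _ _ N) ?leq_max ?leqnn ?orbT //.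
by rewrite -big_split; apply: eq_bigr => n _; rewrite /hact zetaD cmpDr.
Qed.

(* Via [phi_X], the ring acts on [Hom^*(X,Y)] from the right, by precomposition;
   a right [R]-module is a left module over the converse ring [R^c]. *)
HB.instance Definition _ :=
  GRing.Zmodule_isLmodule.Build R^c (homStar A)
    hscaleA hscale1 hscaleDr hscaleDl.

End HomStar.

Section Noetherian.
Variables (S : pzRingType) (V : lmodType S).

Definition is_submodule (N : set V) : Prop :=
  N 0 /\ forall a u v, N u -> N v -> N (a *: u + v).

Definition generated_by (s : seq V) (N : set V) : Prop :=
  forall v, N v <-> exists a : 'I_(size s) -> S, v = \sum_i a i *: s`_i.

Definition noetherian_submodule (M : set V) : Prop :=
  is_submodule M /\
  forall N, is_submodule N -> N `<=` M -> exists s, generated_by s N.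

End Noetherian.

Section Finiteness.
Variables (R : gradedRing) (T : triangulated) (A : central_action R T).
Variables X Y : T.

Definition hom_ge (n0 : int) : set (homStar X Y A) :=
  [set f : homStar X Y A | forall k : int, k < n0 -> f k = 0].

Lemma hom_ge_submodule n0 : is_submodule (hom_ge n0).
Proof.
split=> [//|r f g f0 g0 k lt_k]; rewrite [LHS]/=.
rewrite [X in X + _](_ : _ = 0) ?add0r ?g0 //.
by rewrite /= /hscale_fun big1 // => n _; apply/hactf0/f0; rewrite subzE; lia.
Qed.

Definition R0_submodule (n : int) (N : set (hom X (suspow T n Y))) : Prop :=
  [/\ N 0, forall f g, N f -> N g -> N (f - g)
    & forall r f, homogeneous 0%N r -> N f -> N (f ∘ zeta A 0%N r X)].

Definition R0_chain (n : int) (l : nat) : Prop :=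
  exists N : nat -> set (hom X (suspow T n Y)),
    (forall i, (i <= l)%N -> R0_submodule (N i)) /\
    (forall i, (i < l)%N -> N i `<` N i.+1).

(* The R_0-module Hom(X, Sigma^n Y) has (finite) length [l]. *)
Definition R0_length (n : int) (l : nat) : Prop :=
  R0_chain n l /\ forall l', R0_chain n l' -> (l' <= l)%N.

Definition ev_noetherian_finite_length : Prop :=
  exists n0 : int, noetherian_submodule (hom_ge n0) /\
    forall n, n0 <= n -> exists l, R0_length n l.

Definition cx_bound (K : realType) (t : nat) : Prop :=
  exists (a : K) (N : nat), forall n : nat, (N <= n)%N ->
    exists2 l, R0_length n%:Z l & l%:R <= a * n%:R ^ (t%:Z - 1).

(* The infimum over the empty set is infinite, so no [c] satisfies [is_cx]. *)
Definition is_cx (K : realType) (c : nat) : Prop :=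
  cx_bound K c /\ forall t, cx_bound K t -> (c <= t)%N.

End Finiteness.

Section Koszul.
Variables (R : gradedRing) (T : triangulated) (A : central_action R T).

(* [Z] is a Koszul object [X//r], where [r] is regarded in degree [d]: the zero
   element is homogeneous of every degree. *)
Definition is_koszul (d : nat) (r : R) (X Z : T) : Prop :=
  exists (v : hom (powF sus d X) Z) (w : hom Z (sus X)), dist (zeta A d r X) v w.

(* [Z i] is [X//(r_1,...,r_i)].  Koszul objects are only defined up to
   isomorphism, so some choice of them is quantified over. *)
Definition reduces_complexity (K : realType) (X : T) (c : nat)
    (d : 'I_c -> nat) (r : 'I_c -> R) : Prop :=
  [/\ is_cx A X X K c,
      forall i, (0 < d i)%N /\ homogeneous (d i) (r i)
    & exists Z : nat -> T, Z 0%N = X /\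
        forall i : 'I_c, is_koszul (d i) (r i) (Z i) (Z i.+1) /\
                         is_cx A (Z i.+1) (Z i.+1) K (c - i.+1)].

End Koszul.

Section Subcategories.
Variable T : triangulated.

Definition is_thick (C : set T) : Prop :=
  [/\ exists2 Z, C Z & is_zero_object Z,
      forall X, C X -> C (sus X),
      forall X, C X -> C (desus X),
      forall (X Y Z : T) (u : hom X Y) (v : hom Y Z) (w : hom Z (sus X)),
        dist u v w -> C X -> C Y -> C Z
    & forall X Y, direct_summand X Y -> C Y -> C X].

Definition thick (X : T) : set T :=
  [set Y | forall C, is_thick C -> C X -> C Y].

Definition hom_vanishes (X Y : T) (n : int) : Prop :=
  forall f : hom X (suspow T n Y), f = 0.

Definition eventually_zero (X Y : T) : Prop :=
  exists N : int, forall n, N <= n -> hom_vanishes X Y n.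

Definition left_auslander (C : set T) : Prop :=
  forall X, C X -> exists d : int, forall Y, eventually_zero X Y ->
    forall n, d <= n -> hom_vanishes X Y n.

Definition right_auslander (C : set T) : Prop :=
  forall X, C X -> exists d : int, forall Y, eventually_zero Y X ->
    forall n, d <= n -> hom_vanishes Y X n.

End Subcategories.

(* Main.v *)
(* If [Z = X//(r_1,...,r_c)] then [Hom^*(Z,Z)] is eventually zero, because
   [cx Z = 0].  The Auslander bound for [Z] is uniform in the other argument, and
   that argument may be replaced by any of its suspensions, so [Hom(Z,Z) = 0] and
   [Z] vanishes.  Passing from [X//(r_1,...,r_i)] to [X//(r_1,...,r_(i+1))]
   shortens a window of vanishing by [|r_(i+1)| - 1]; going back, once all
   Hom groups out of [X//(r_1,...,r_(i+1))] vanish, those out of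
   [X//(r_1,...,r_i)] are periodic of period [|r_(i+1)|], and the window
   contains a full period. *)
Require Import Defs.
From mathcomp Require Import all_boot all_order all_algebra.
From mathcomp Require Import boolp classical_sets.
From mathcomp Require Import reals.
From mathcomp Require Import zify.

Set Implicit Arguments.
Unset Strict Implicit.
Unset Printing Implicit Defensive.

Import Order.TTheory GRing.Theory Num.Theory.
(* [vector] also defines [hom]. *)
Import Defs.

Local Open Scope ring_scope.

(** * Isomorphic objects and vanishing Hom groups *)

Section Isomorphisms.
Variable C : preadditive.
Implicit Types X Y Z : C.

Definition isomorphic X Y : Prop := exists f : hom X Y, is_iso f.

(** [hom_vanishes X Y n] is convertible to [no_hom X (suspow T n Y)], so facts about [no_hom] apply
    to it directly. *)
Definition no_hom X Y : Prop := forall f : hom X Y, f = 0.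

Lemma isomorphic_refl X : isomorphic X X.
Proof. by exists (idm X), (idm X); rewrite cmp1m. Qed.

Lemma isomorphic_sym X Y : isomorphic X Y -> isomorphic Y X.
Proof. by case=> f [g [gf fg]]; exists g, f. Qed.

Lemma isomorphic_trans X Y Z :
  isomorphic X Y -> isomorphic Y Z -> isomorphic X Z.
Proof.
move=> [f [f' [f'f ff']]] [g [g' [g'g gg']]]; exists (g ∘ f), (f' ∘ g').
by split; rewrite -cmpA [X in _ ∘ X]cmpA ?g'g ?ff' cmp1m.
Qed.

Lemma fob_isomorphic (F : endofunctor C) X Y :
  isomorphic X Y -> isomorphic (F X) (F Y).
Proof.
move=> [f [g [gf fg]]]; exists (fmap F f), (fmap F g).
by rewrite -!fmapM gf fg !fmap1.
Qed.

Lemma no_hom_isor X Y Y' : isomorphic Y Y' -> no_hom X Y -> no_hom X Y'.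
Proof.
by move=> [f [g [_ fg]]] XY0 h; rewrite -[h]cmp1m -fg -cmpA (XY0 (g ∘ h)) cmpm0.
Qed.

End Isomorphisms.

(** * Periodic predicates on the integers *)

Lemma periodic_window (P : int -> Prop) (n : nat) (a : int) : (0 < n)%N ->
  (forall i, P i <-> P (i - n%:Z)) ->
  (forall i, a <= i -> i < a + n%:Z -> P i) -> forall i, P i.
Proof.
move=> n_gt0 per win.
have up k i : a <= i -> i < a + (k * n)%N%:Z -> P i.
  elim: k i => [|k IHk] i le_ai lt_i; first by lia.
  case: (ltP i (a + n%:Z)) => [|le_i]; first exact: win.
  by apply/per/IHk; lia.
have down k i : a - (k * n)%N%:Z <= i -> P i.
  (* Since [n >= 1], [|i - a| + 1] periods reach beyond any [i >= a]. *)
  elim: k i => [|k IHk] i le_i; first by apply: (up `|i - a|.+1); nia.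
  suff /per : P (i + n%:Z) by rewrite addrK.
  by apply: IHk; lia.
by move=> i; apply: (down `|i - a|%N); nia.
Qed.

(** * Moving suspensions across Hom *)

Section Triangulated.
Variable T : triangulated.
Implicit Types X Y Z : T.

Lemma is_iso_inj (X Y Y' : T) (f : hom Y Y') (g h : hom X Y) :
  is_iso f -> f ∘ g = f ∘ h -> g = h.
Proof. by case=> f' [f'f _] e; rewrite -[g]cmp1m -f'f -cmpA e cmpA f'f cmp1m. Qed.

Lemma sus_inj X Y (f g : hom X Y) : fmap sus f = fmap sus g -> f = g.
Proof. by move=> e; apply: (is_iso_inj (sus_unit_iso Y)); rewrite !sus_unit_nat e. Qed.

Lemma desus_inj X Y (f g : hom X Y) : fmap desus f = fmap desus g -> f = g.
Proof.
move=> e; have [h [_ ch]] := sus_counit_iso X.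
rewrite -[f]cmpm1 -[g]cmpm1 -ch !cmpA.
by rewrite !sus_counit_nat e.
Qed.

Lemma sus_full X Y (g : hom (sus X) (sus Y)) : exists f, g = fmap sus f.
Proof.
have [h [hu uh]] := sus_unit_iso Y.
(* The preimage is [desus g] transported along the units; by naturality its suspension agrees with
   [g] after the faithful [desus]. *)
exists (h ∘ fmap desus g ∘ sus_unit X); apply: desus_inj.
have [k [ku uk]] := sus_unit_iso X.
rewrite -[RHS]cmpm1 -uk cmpA -sus_unit_nat !cmpA uh cmp1m.
by rewrite -cmpA uk cmpm1.
Qed.

Lemma no_hom_sus X Y : no_hom (sus X) (sus Y) <-> no_hom X Y.
Proof.
split=> XY0 f; first by apply: sus_inj; rewrite fmap0; apply: XY0.
by have [g ->] := sus_full f; rewrite (XY0 g) fmap0.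
Qed.

Lemma sus_suspow_predz k X : isomorphic (sus (suspow T (predz k) X)) (suspow T k X).
Proof.
exists (powz_succ k X).
case: k => [[|n]|n]; [exact: sus_counit_iso | | exact: sus_counit_iso].
by exists (idm _); rewrite cmp1m.
Qed.

(** Suspension is fully faithful, and suspending the power [i - 1] of [Y] gives the power [i] up to
    isomorphism. *)
Lemma hom_vanishes_sus X Y i :
  hom_vanishes (sus X) Y i <-> hom_vanishes X Y (i - 1).
Proof.
have iso_i := sus_suspow_predz i Y; rewrite -predzE.
split=> [XY0 | /no_hom_sus XY0]; last exact: (no_hom_isor iso_i XY0).
exact/no_hom_sus/(no_hom_isor (isomorphic_sym iso_i) XY0).
Qed.

Lemma hom_vanishes_powsus n X Y i :
  hom_vanishes (powF sus n X) Y i <-> hom_vanishes X Y (i - n%:Z).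
Proof.
elim: n i => [|n IHn] i; first by rewrite subr0.
have -> : i - n.+1%:Z = i - 1 - n%:Z by lia.
by rewrite -IHn -hom_vanishes_sus.
Qed.

Lemma powsus_comm n X : isomorphic (powF sus n (sus X)) (sus (powF sus n X)).
Proof.
elim: n => [|n IHn] /=; first exact: isomorphic_refl.
exact: fob_isomorphic.
Qed.

Lemma powsus_powdesus n X : isomorphic (powF sus n (powF desus n X)) X.
Proof.
elim: n => [|n IHn]; first exact: isomorphic_refl.
apply: isomorphic_trans IHn.
apply: isomorphic_trans (isomorphic_sym (powsus_comm _ _)) _.
apply/fob_isomorphic; exists (sus_counit (powF desus n X)).
exact: sus_counit_iso.
Qed.

Lemma powsusD n m X :
  isomorphic (powF sus n (powF sus m X)) (powF sus (n + m) X).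
Proof.
elim: n => [|n IHn] /=; first exact: isomorphic_refl.
exact: fob_isomorphic.
Qed.

(** * Vanishing along triangles *)

Lemma dist_no_hom X Y Z W (u : hom X Y) (v : hom Y Z) (w : hom Z (sus X)) :
  dist u v w -> no_hom X W -> no_hom Z W -> no_hom Y W.
Proof.
move=> uvw XW0 ZW0 g.
have [O O0] := zero_object T.
have sO0 : is_zero_object (sus O).
  have idO0 : idm (sus O) = 0 by rewrite -fmap1 ((O0 O).1 (idm O)) fmap0.
  move=> V; split=> f; first by rewrite -[f]cmp1m idO0 cmp0m.
  by rewrite -[f]cmpm1 idO0 cmpm0.
(* As [g] kills [u], a morphism into the triangle [O -> W -> W] factors [g] through [v]. *)
have OWW : dist (0 : hom O W) (idm W) (0 : hom W (sus O)).
  by apply/dist_rot; rewrite fmap0 oppr0; apply: dist_id.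
have comm : g ∘ u = (0 : hom O W) ∘ (0 : hom X O) by rewrite cmp0m; apply: XW0.
have [h [hv _]] := dist_mor uvw OWW comm.
by rewrite -[g]cmp1m -hv (ZW0 h) cmp0m.
Qed.

Section PowerTriangle.
Variables (n : nat) (X Z Y : T).
Variables (u : hom X (powF sus n X)) (v : hom (powF sus n X) Z).
Variable w : hom Z (sus X).
Hypothesis uvw : dist u v w.

(** The rotated triangle puts [Z] between the [n]-th suspension of [X] and [sus X]; these account
    for the degrees [i - n] and [i - 1]. *)
Lemma hom_vanishes_cone i : hom_vanishes X Y (i - 1) ->
  hom_vanishes X Y (i - n%:Z) -> hom_vanishes Z Y i.
Proof.
move=> /hom_vanishes_sus sX0 /hom_vanishes_powsus pX0.
exact: (dist_no_hom ((dist_rot _ _ _).1 uvw) pX0 sX0).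
Qed.

Lemma hom_vanishes_period : (forall i, hom_vanishes Z Y i) ->
  forall i, hom_vanishes X Y i <-> hom_vanishes X Y (i - n%:Z).
Proof.
move=> Z0 i; split=> X0.
  by apply/hom_vanishes_powsus/(dist_no_hom uvw X0 (Z0 i)).
rewrite -(addrK 1 i); apply/hom_vanishes_sus.
(* Two rotations make [sus X] the middle term, hence the passage to degree [i + 1]. *)
apply: (dist_no_hom ((dist_rot _ _ _).1 ((dist_rot _ _ _).1 uvw)) (Z0 _)).
by apply/hom_vanishes_sus/hom_vanishes_powsus; rewrite addrK.
Qed.

End PowerTriangle.

Lemma tower_hom_vanishes (Y : T) (c : nat) (d : 'I_c -> nat) (Z : nat -> T) :
  (forall i, (0 < d i)%N) ->
  (forall i : 'I_c, exists (u : hom (Z i) (powF sus (d i) (Z i)))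
     (v : hom (powF sus (d i) (Z i)) (Z i.+1)) (w : hom (Z i.+1) (sus (Z i))),
     dist u v w) ->
  (forall i, hom_vanishes (Z c) Y i) ->
  forall n : int, (forall i, n <= i ->
    i <= n + (\sum_(j < c) d j)%N%:Z - c%:Z -> hom_vanishes (Z 0%N) Y i) ->
  forall i, hom_vanishes (Z 0%N) Y i.
Proof.
elim: c d Z => [//|c IHc] d Z d_gt0 tri Zc0 n.
rewrite big_ord_recl => win.
have [u [v [w uvw]]] := tri ord0.
have d0_gt0 := d_gt0 ord0.
(* The later degrees are all positive, so the window keeps at least [d ord0] consecutive integers: a
   full period. *)
have le_c : (c <= \sum_(j < c) d (lift ord0 j))%N.
  rewrite -[X in (X <= _)%N]card_ord -sum1_card.
  by apply: leq_sum => j _; apply: d_gt0.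
have Z1_0 : forall i, hom_vanishes (Z 1%N) Y i.
  (* From [n + d ord0] on, both [i - d ord0] and [i - 1] lie in the old window, whose upper end thus
     moves up by one. *)
  apply: (IHc (fun j => d (lift ord0 j)) (fun j => Z j.+1) _ _ _
            (n + (d ord0)%:Z)) => //.
    by move=> j; apply: (tri (lift ord0 j)).
  by move=> i le_i i_le; apply: (hom_vanishes_cone uvw); apply: win; lia.
apply: (periodic_window (a := n) d0_gt0 (hom_vanishes_period uvw Z1_0)).
move=> i le_i i_lt.
by apply: win => //; lia.
Qed.

(** * Thick subcategories, Auslander bounds and complexity zero *)

Lemma thick_self X : thick X X.
Proof. by []. Qed.

Lemma thick_cone_pow n X X' Z (u : hom X' (powF sus n X'))
    (v : hom (powF sus n X') Z) (w : hom Z (sus X')) :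
  dist u v w -> thick X X' -> thick X Z.
Proof.
move=> uvw thX C thC CX; have CX' := thX C thC CX.
have [_ Csus _ Ccone _] := thC; apply: (Ccone _ _ _ _ _ _ uvw CX').
elim: n {u v w uvw} => [|n IHn]; [exact: CX' | exact: Csus IHn].
Qed.

Lemma auslander_eventually_zero (C : set T) X :
  left_auslander C \/ right_auslander C -> C X ->
  eventually_zero X X -> no_hom X X.
Proof.
move=> ausC CX [N ev0].
case: ausC => /(_ X CX) [d aus]; pose n := `|d|%N.
  have iso_n := powsus_powdesus n X.
  (* Left case: desuspending the target [n >= d] times turns degree 0 into degree [n]. *)
  apply: (no_hom_isor iso_n); apply: (aus (powF desus n X) _ n%:Z); last by lia.
  exists (n + `|N|)%N%:Z => m le_m.
  have -> : m = (`|m| - n + n)%N%:Z by lia.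
  apply: (no_hom_isor (powsusD _ _ _)).
  apply: (no_hom_isor (fob_isomorphic _ (isomorphic_sym iso_n))).
  by apply: (ev0 (`|m| - n)%N%:Z); lia.
(* Right case: the source is suspended instead. *)
suff : hom_vanishes (powF sus n X) X n%:Z.
  by move/hom_vanishes_powsus; rewrite subrr.
apply: aus; last by lia.
by exists (N + n%:Z) => m le_m; apply/hom_vanishes_powsus/ev0; lia.
Qed.

(** A nonzero map would make zero and the whole group a chain of length one. *)
Lemma R0_length0 (R : gradedRing) (A : central_action R T) X Y n :
  R0_length A X Y n 0%N -> hom_vanishes X Y n.
Proof.
move=> [_ max0] f; apply: contrapT => f_neq0.
suff /max0 : R0_chain A X Y n 1%N by [].
exists (fun i => if i is 0%N then [set 0]%classic else setT); split.
  case=> [|i] _; split=> //=; first by move=> g h -> ->; rewrite subr0.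
  by move=> s g _ ->; rewrite cmp0m.
by case=> // _; split=> // /(_ f I)/f_neq0.
Qed.

Lemma cx0_eventually_zero (K : realType) (R : gradedRing)
    (A : central_action R T) X Y : is_cx A X Y K 0 -> eventually_zero X Y.
Proof.
move=> [[a [N bound]] _].
(* For [t = 0] the bound is [a / n], which is below 1 once [n] is at least [M > |a|]. *)
have := truncnS_gt `|a|; set M := (Num.truncn _).+1 => a_lt_M.
exists (N + M)%N%:Z => n le_n.
have -> : n = `|n|%N%:Z by lia.
have [|l len_l le_l] := bound `|n|%N; first by lia.
have n_gt0 : (0 < `|n|)%N by lia.
suff l0 : l = 0%N by rewrite l0 in len_l; exact: R0_length0 len_l.
move: le_l; rewrite sub0r exprN1 ler_pdivlMr ?ltr0n // => le_l.
case: l {len_l} le_l => // l le_l.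
have a_lt : `|a| < `|n|%N%:R.
  by apply: lt_le_trans a_lt_M _; rewrite ler_nat; lia.
have : (l.+1%:R * `|n|%N%:R : K) < `|n|%N%:R.
  by apply: le_lt_trans le_l (le_lt_trans (ler_norm a) a_lt).
by rewrite -natrM ltr_nat; nia.
Qed.

End Triangulated.

Theorem theorem3p2 (K : realType) (T : triangulated) (X Y : T)
    (R : gradedRing) (A : central_action R T)
    (c : nat) (d : 'I_c -> nat) (r : 'I_c -> R) :
  graded_commutative R ->
  ev_noetherian_finite_length A X X ->
  left_auslander (thick X) \/ right_auslander (thick X) ->
  reduces_complexity A K X d r ->
  (exists n : int, forall i : int,
     n <= i -> i <= n + (\sum_(j < c) d j)%N%:Z - c%:Z -> hom_vanishes X Y i)
  <->
  (forall i : int, hom_vanishes X Y i).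
Proof.
move=> _ _ aus [cxX d_gt0 [Z [Z0 tower]]].
split=> [[n win]|XY0]; last by exists 0 => i _ _; apply: XY0.
have thZ m : (m <= c)%N -> thick X (Z m).
  elim: m => [|m IHm] lt_mc; first by rewrite Z0; apply: thick_self.
  have [[v [w uvw]] _] := tower (Ordinal lt_mc).
  exact: thick_cone_pow uvw (IHm (ltnW lt_mc)).
have cxZ : is_cx A (Z c) (Z c) K 0.
  (* For [c = 0] the tower is empty and the complexity of [X] itself is used. *)
  case: c d r d_gt0 tower thZ cxX win => [|c] d r _ tower _ cxX _.
    by rewrite Z0.
  by have [_] := tower ord_max; rewrite subnn.
have idZ0 : idm (Z c) = 0.
  have := auslander_eventually_zero aus (thZ c (leqnn c)).
  by apply; apply: cx0_eventually_zero cxZ.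
rewrite -Z0 in win *.
apply: (tower_hom_vanishes (fun i => (d_gt0 i).1) _ _ win).
  by move=> i; have [[v [w uvw]] _] := tower i; exists (zeta A (d i) (r i) (Z i)), v, w.
by move=> i f; rewrite -[f]cmpm1 idZ0 cmpm0.
Qed.
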